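(* Suppose $|a|_p>\alpha=\beta$. Then the $p$-adic dynamical system generated by $f$ has the following properties. 1. (1.1) $SI(x_1)=U_{\alpha^2/|a|_p}(0)$. (1.2) $x_2\in S_{|a|_p}(0)$. 2. The fixed point $x_2$ is attractive and $A(x_2)=\mathbb C_p\setminus\big(V_{\alpha^2/|a|_p}(0)\cup\mathcal P\big)$. 3. If $x\in S_{\alpha^2/|a|_p}(0)$, then one of the following two possibilities holds: (3.1) there exist $k\in\mathbb N$ and $\mu_k<\alpha^2/|a|_p$ such that $f^m(x)\in S_{\mu_k}(0)$ for all $m\ge k$ and $f^m(x)\in S_{\alpha^2/|a|_p}(0)$ for $m\le k-1$; (3.2) the trajectory $\{f^k(x):k\ge1\}$ is a subset of $S_{\alpha^2/|a|_p}(0)$.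
   Context: $p$ is a prime and $\mathbb C_p$ is the field of complex $p$-adic numbers with norm $|\cdot|_p$. Let $a,b,d\in\mathbb C_p$ with $ab\neq0$, $a\ne d$, and $$f(x)=\frac{ax^2+bx}{x^2+dx+b},\qquad x\in\mathbb C_p\setminus\{\hat x_1,\hat x_2\},$$ where $\hat x_1,\hat x_2\in\mathbb C_p$ are the two (possibly equal) roots of $x^2+dx+b$. Put $\alpha=|\hat x_1|_p$, $\beta=|\hat x_2|_p$, labelled so that $\alpha\le\beta$. Standing assumption: $f$ has the two distinct fixed points $x_1=0$ and $x_2=a-d$ (in particular $x_2\notin\{\hat x_1,\hat x_2\}$, i.e. $b+a(a-d)\neq0$). $\mathcal P=\{x\in\mathbb C_p:\exists n\in\mathbb N\cup\{0\},\ f^n(x)\in\{\hat x_1,\hat x_2\}\}$, where $f^n$ is the $n$-th iterate ($f^0=\mathrm{id}$). For $c\in\mathbb C_p$, $r\geq 0$: $U_r(c)=\{x:|x-c|_p<r\}$, $V_r(c)=\{x:|x-c|_p\le r\}$, $S_r(c)=\{x:|x-c|_p=r\}$ (so $S_0(0)=\{0\}$; $\mu_k$ denotes a nonnegative real, possibly $0$). A fixed point $x_0$ is attractive, indifferent, repeller if $|f'(x_0)|_p<1$, $=1$, $>1$ respectively. The basin of attraction is $A(x_0)=\{x: f^n(x)\text{ is defined for all }n\text{ and }f^n(x)\to x_0\}$. A sphere $S$ is invariant if $f$ is defined on $S$ and $f(S)\subset S$. An open ball $U_r(x_0)$ about a fixed point $x_0$ is a Siegel disk if every sphere $S_\rho(x_0)$,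 $0<\rho<r$, is invariant; $SI(x_0)$ is the union of all Siegel disks centred at $x_0$ (the maximal Siegel disk). *)

(* Defs.v *)
From HB Require Import structures.
From mathcomp Require Import all_boot all_order all_algebra.
From mathcomp Require Import all_classical all_reals all_analysis.

Set Implicit Arguments.
Unset Strict Implicit.
Unset Printing Implicit Defensive.

Import Order.TTheory GRing.Theory Num.Theory.
Import numFieldNormedType.Exports.
Local Open Scope classical_set_scope.
Local Open Scope ring_scope.

Section Valued.
Variables (R : realType) (K : fieldType) (N : K -> R).

Definition seq_cvg (u : nat -> K) (l : K) : Prop :=
  N (u n - l) @[n --> \oo] --> (0 : R).

Definition seq_cauchy (u : nat -> K) : Prop :=
  forall e : R, 0 < e -> exists n0 : nat, forall m n : nat,
    (n0 <= m)%N -> (n0 <= n)%N -> N (u m - u n) < e.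

(* The topological closure of the prime field: when K is complete and N
   restricts to the p-adic norm on the rationals, this is a copy of Q_p. *)
Definition rat_closure : set K :=
  [set x | forall e : R, 0 < e -> exists q : rat, N (x - ratr q) < e].

Definition algebraic_over (F : set K) : set K :=
  [set x | exists P : {poly K}, [/\ P != 0, forall i, F P`_i & root P x]].

Definition norm_dense (A : set K) : Prop :=
  forall (x : K) (e : R), 0 < e -> exists2 y, A y & N (x - y) < e.

End Valued.

(* C_p, the completion of an algebraic closure of Q_p, given by the axioms that
   determine it up to isometric isomorphism: a complete algebraically closed
   field whose norm extends the p-adic norm (pnorm_p and the ultrametric
   inequality force this on the rationals, and force characteristic 0), in which
   the elements algebraic over Q_p are dense. *)
Record complexPadicField (R : realType) (p : nat) := ComplexPadicField {
  Cp_sort :> fieldType;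
  pnorm : Cp_sort -> R;
  pnorm_ge0 : forall x, 0 <= pnorm x;
  pnorm_eq0 : forall x, pnorm x = 0 <-> x = 0;
  pnormM : forall x y, pnorm (x * y) = pnorm x * pnorm y;
  pnormD : forall x y, pnorm (x + y) <= Num.max (pnorm x) (pnorm y);
  pnorm_p : pnorm p%:R = p%:R^-1;
  Cp_complete : forall u : nat -> Cp_sort,
    seq_cauchy pnorm u -> exists l, seq_cvg pnorm u l;
  Cp_closed : GRing.closed_field_axiom Cp_sort;
  Cp_dense : norm_dense pnorm (algebraic_over (rat_closure pnorm))
}.

Section Dynamics.
Variables (R : realType) (p : nat) (Cp : complexPadicField R p).
Implicit Types (x c : Cp) (r : R) (A : set Cp).

Definition openBall r c : set Cp := [set x | pnorm (x - c) < r].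
Definition closedBall r c : set Cp := [set x | pnorm (x - c) <= r].
Definition sphere r c : set Cp := [set x | pnorm (x - c) = r].

(* Partial self-maps: g x = None means that g is undefined at x. *)
Variable g : Cp -> option Cp.

Definition piter (n : nat) x : option Cp := iter n (obind g) (Some x).

Definition piter_in (n : nat) x A : Prop :=
  exists2 y, piter n x = Some y & A y.

Definition is_fixed_point x : Prop := g x = Some x.

Definition has_derivative x (l : Cp) : Prop :=
  exists2 y, g x = Some y &
    forall e : R, 0 < e -> exists2 delta : R, 0 < delta &
      forall z, z != x -> pnorm (z - x) < delta ->
        exists2 w, g z = Some w & pnorm ((w - y) / (z - x) - l) < e.

Definition attractive x : Prop :=
  is_fixed_point x /\ exists2 l, has_derivative x l & pnorm l < 1.

Definition basin (x0 : Cp) : set Cp :=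
  [set x | exists2 u : nat -> Cp,
     forall n, piter n x = Some (u n) & seq_cvg (@pnorm R p Cp) u x0].

Definition invariant A : Prop :=
  forall x, A x -> exists2 y, g x = Some y & A y.

Definition siegel_disk r (x0 : Cp) : Prop :=
  [/\ 0 < r, is_fixed_point x0 &
      forall rho : R, 0 < rho -> rho < r -> invariant (sphere rho x0)].

Definition SI (x0 : Cp) : set Cp :=
  [set x | exists2 r, siegel_disk r x0 & openBall r x0 x].

Definition pole_orbits (h1 h2 : Cp) : set Cp :=
  [set x | exists n, piter_in n x [set h1; h2]].

End Dynamics.

Definition ratmap (R : realType) (p : nat) (Cp : complexPadicField R p)
    (a b d : Cp) (x : Cp) : option Cp :=
  if x ^+ 2 + d * x + b == 0 then None
  else Some ((a * x ^+ 2 + b * x) / (x ^+ 2 + d * x + b)).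

(* Main.v *)
From HB Require Import structures.
From mathcomp Require Import all_boot all_order all_algebra.
From mathcomp Require Import all_classical all_reals all_analysis.
From mathcomp Require Import ring.
Require Import Defs.

(** With [b = h1 h2] and [d = - (h1 + h2)], the map is
[f x = x (a x + b) / ((x - h1) (x - h2))], and the strong triangle inequality
controls [|f x|] by [|x|] as soon as [|h1| <= |h2| < |a|]. Put [r = |b| / |a|].
Then [|f x| = |x|] for [|x| < r] and [|f x| <= r] for [|x| = r]; the norm grows
at least geometrically for [r < |x| <= |h2|], even on the spheres carrying the
poles; and [|f x| = |a|] for [|x| > |h2|]. Hence an orbit that starts outside
the closed ball of radius [r] and avoids the poles reaches the sphere of radius
[|a|], where [f x - x2 = (x - x2) (d x + b) / (x ^ 2 + d x + b)] shows that [f]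
contracts towards [x2 = a - d] with ratio [|h2| / |a|]. The Siegel disk stops at
[r] because [- b / a], of norm [r], is mapped to [0]. *)

Set Implicit Arguments.
Unset Strict Implicit.
Unset Printing Implicit Defensive.

Import Order.TTheory GRing.Theory Num.Theory.
Import numFieldNormedType.Exports.
Local Open Scope classical_set_scope.
Local Open Scope ring_scope.

Lemma exists_expr_gt (R : archiRealFieldType) (q c : R) :
  1 < q -> exists n, c < q ^+ n.
Proof.
move=> q1; have q0 : 0 < q by exact: lt_trans q1.
have qV1 : `|q^-1| < 1 by rewrite gtr0_norm ?invr_gt0// invf_lt1.
have [n _ /(_ n (leqnn n))] :=
  (cvgrPdist_lt _ _).1 (cvg_geometric c qV1) _ ltr01.
rewrite /= sub0r normrN normrM exprVn normfV (gtr0_norm (exprn_gt0 n q0)).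
rewrite ltr_pdivrMr ?exprn_gt0// mul1r => cq.
by exists n; exact: le_lt_trans (ler_norm c) cq.
Qed.

Section PadicNorm.
Variables (R : realType) (p : nat) (Cp : complexPadicField R p).
Implicit Types x y : Cp.

Lemma pnorm0 : pnorm (0 : Cp) = 0.
Proof. exact/pnorm_eq0. Qed.

Lemma pnorm_gt0 x : (0 < pnorm x) = (x != 0).
Proof.
rewrite lt_neqAle pnorm_ge0 andbT eq_sym; congr (~~ _).
by apply/eqP/eqP => /pnorm_eq0.
Qed.

Lemma pnorm1 : pnorm (1 : Cp) = 1.
Proof.
have n1 : pnorm (1 : Cp) != 0 by rewrite gt_eqF// pnorm_gt0 oner_neq0.
by apply: (mulfI n1); rewrite -pnormM !mulr1.
Qed.

Lemma pnormN x : pnorm (- x) = pnorm x.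
Proof.
apply/eqP; rewrite -(eqrXn2 (n := 2)) ?pnorm_ge0//.
by rewrite !expr2 -!pnormM mulrNN.
Qed.

Lemma pnormV x : pnorm x^-1 = (pnorm x)^-1.
Proof.
have [->|x0] := eqVneq x 0; first by rewrite invr0 pnorm0 invr0.
have nx : pnorm x != 0 by rewrite gt_eqF// pnorm_gt0.
by apply: (mulfI nx); rewrite -pnormM !divff// pnorm1.
Qed.

Lemma pnorm_div x y : pnorm (x / y) = pnorm x / pnorm y.
Proof. by rewrite pnormM pnormV. Qed.

Lemma pnormD_le x y (s : R) :
  pnorm x <= s -> pnorm y <= s -> pnorm (x + y) <= s.
Proof. by move=> xs ys; rewrite (le_trans (pnormD x y))// ge_max xs. Qed.

Lemma pnormB_le x y (s : R) :
  pnorm x <= s -> pnorm y <= s -> pnorm (x - y) <= s.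
Proof. by move=> xs ys; rewrite pnormD_le// pnormN. Qed.

Lemma pnormD_ltl x y : pnorm x < pnorm y -> pnorm (x + y) = pnorm y.
Proof.
move=> xy; apply/eqP; rewrite eq_le pnormD_le ?(ltW xy)//=.
have := pnormD (x + y) (- x); rewrite addrAC subrr add0r pnormN le_max.
by case/orP => //; rewrite leNgt xy.
Qed.

Lemma pnormD_ltr x y : pnorm y < pnorm x -> pnorm (x + y) = pnorm x.
Proof. by rewrite addrC; exact: pnormD_ltl. Qed.

Lemma pnormB_ltl x y : pnorm x < pnorm y -> pnorm (x - y) = pnorm y.
Proof. by move=> xy; rewrite pnormD_ltl pnormN. Qed.

Lemma pnormB_ltr x y : pnorm y < pnorm x -> pnorm (x - y) = pnorm x.
Proof. by move=> xy; rewrite pnormD_ltr ?pnormN. Qed.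

Lemma sphere0E (s : R) x : sphere s 0 x = (pnorm x = s).
Proof. by rewrite /sphere /= subr0. Qed.

Lemma closedBall0E (s : R) x : closedBall s 0 x = (pnorm x <= s).
Proof. by rewrite /closedBall /= subr0. Qed.

End PadicNorm.

Section PartialMap.
Variables (R : realType) (p : nat) (Cp : complexPadicField R p).
Variable g : Cp -> option Cp.
Implicit Types (x y : Cp) (A B : set Cp) (r : R).

Lemma piterD m n x : piter g (m + n) x = obind (piter g m) (piter g n x).
Proof.
elim: m => [|m IH]; first by rewrite add0n; case: (piter g n x).
by rewrite addSn -[LHS]/(obind g (piter g (m + n) x)) IH; case: (piter g n x).
Qed.

Lemma piter_inS n x A B : piter_in g n x A ->
  (forall y, A y -> exists2 z, g y = Some z & B z) -> piter_in g n.+1 x B.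
Proof.
move=> [y xy Ay] /(_ y Ay)[z yz Bz]; exists z => //.
by rewrite -add1n piterD xy.
Qed.

Lemma invariant_piter A k m x : invariant g A -> (k <= m)%N ->
  piter_in g k x A -> piter_in g m x A.
Proof.
move=> gA /subnKC <- xA; elim: (m - k)%N => [|j IH]; first by rewrite addn0.
by rewrite addnS; apply: piter_inS IH gA.
Qed.

Lemma pole_orbitsE h1 h2 : (forall x, g x = None <-> [set h1; h2] x) ->
  pole_orbits g h1 h2 = [set x | exists n, piter g n x = None].
Proof.
move=> gNone; apply/seteqP; split => x [n].
  by move=> [y xy /gNone yN]; exists n.+1; rewrite -add1n piterD xy.
elim: n => [//|n IH]; rewrite -add1n piterD.
case xy : (piter g n x) => [y|]; last by move=> _; exact: IH.
by move/gNone; exists n, y.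
Qed.

Lemma SI_openBall x0 r : 0 < r -> is_fixed_point g x0 ->
  (forall rho, rho < r -> invariant g (sphere rho x0)) ->
  ~ invariant g (sphere r x0) -> SI g x0 = openBall r x0.
Proof.
move=> r0 gx0 inner outer; apply/seteqP; split => x; last first.
  by exists r => //; split => // rho _; exact: inner.
move=> [s [_ _ inv] /lt_le_trans]; apply; rewrite leNgt.
by apply/negP => rs; exact/outer/inv.
Qed.

Lemma sphere_orbit_dichotomy x0 r x :
  (forall mu, mu < r -> invariant g (sphere mu x0)) ->
  invariant g (closedBall r x0) -> sphere r x0 x ->
  (exists (k : nat) (mu : R),
     [/\ (1 <= k)%N, 0 <= mu, mu < r,
         forall m : nat, (k <= m)%N -> piter_in g m x (sphere mu x0) &
         forall m : nat, (m <= k - 1)%N -> piter_in g m x (sphere r x0)])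
  \/ (forall k : nat, (1 <= k)%N -> piter_in g k x (sphere r x0)).
Proof.
move=> inner ball xr.
have orbit n : piter_in g n x (closedBall r x0).
  apply: invariant_piter ball (leq0n n) _.
  by exists x => //; rewrite /closedBall /= xr.
pose off_sphere n := `[< ~ piter_in g n x (sphere r x0) >].
have [leaves|stays] := pselect (exists n, off_sphere n); last first.
  by right=> k _; apply: contrapT => xk; apply: stays; exists k; exact/asboolP.
left; case: (ex_minnP leaves) => k /asboolP xk kmin.
have k_gt0 : (0 < k)%N.
  by rewrite lt0n; apply: contra_notN xk => /eqP ->; exists x.
have [y xy yr] := orbit k; exists k, (pnorm (y - x0)).
have y_lt : pnorm (y - x0) < r.
  by rewrite lt_neqAle yr andbT; apply: contra_notN xk => /eqP; exists y.
split => // [|m km|m].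
- exact: pnorm_ge0.
- by apply: invariant_piter (inner _ y_lt) km _; exists y.
- rewrite subn1 -ltnS prednK// ltnNge => mk.
  by apply: contrapT => /asboolP /kmin; apply/negP.
Qed.

Lemma basin_total x0 x n : basin g x0 x -> piter g n x <> None.
Proof. by move=> [u -> _]. Qed.

Lemma basin_disjoint x0 A (e : R) x : 0 < e -> invariant g A ->
  (forall y, A y -> e <= pnorm (y - x0)) -> A x -> ~ basin g x0 x.
Proof.
move=> e0 gA far Ax [u uE ucvg].
have [n _ /(_ n (leqnn n))] := (cvgrPdist_lt _ _).1 ucvg _ e0.
rewrite /= sub0r normrN ger0_norm ?pnorm_ge0// ltNge => /negP; apply.
have [|y] := @invariant_piter A 0 n x gA (leq0n n); first by exists x.
by rewrite uE => -[->] /far.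
Qed.

Lemma basin_piter x0 n x : piter_in g n x (basin g x0) -> basin g x0 x.
Proof.
move=> [y xy [u uE ucvg]].
have xD m : piter g (m + n) x = Some (u m) by rewrite piterD xy /= uE.
exists (fun m => odflt x0 (piter g m x)) => [m|].
  case: (leqP n m) => [/subnK <-|mn]; first by rewrite xD.
  by case xm : (piter g m x) xy => [//|]; rewrite -(subnK (ltnW mn)) piterD xm.
rewrite /seq_cvg -(cvg_shiftn n) /=.
by under eq_fun do rewrite xD.
Qed.

Lemma basin_contraction x0 A (q : R) : 0 <= q -> q < 1 ->
  (forall y, A y ->
     exists2 z, g y = Some z & A z /\ pnorm (z - x0) <= q * pnorm (y - x0)) ->
  A `<=` basin g x0.
Proof.
move=> q0 q1 contr x Ax; pose c := pnorm (x - x0).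
have orbit n : piter_in g n x [set y | A y /\ pnorm (y - x0) <= c * q ^+ n].
  elim: n => [|n IH]; first by exists x; rewrite //= mulr1.
  apply: piter_inS IH _ => y [/contr[z yz [Az zy] yc]].
  exists z => //; split => //.
  by apply: le_trans zy _; rewrite exprS mulrCA ler_wpM2l.
exists (fun n => s2val (cid2 (orbit n))) => [n|].
  exact: s2valP (cid2 (orbit n)).
apply: (squeeze_cvgr (f := fun=> 0) (h := geometric c q)); last 2 first.
- exact: cvg_cst.
- by apply: cvg_geometric; rewrite ger0_norm.
by apply: nearW => n /=; rewrite pnorm_ge0; have [] := s2valP' (cid2 (orbit n)).
Qed.

Lemma expanding_orbit_escapes (phi : Cp -> R) (q s t : R) x : 1 < q -> 0 < s ->
  (forall y z, s <= phi y <= t -> g y = Some z -> q * phi y <= phi z) ->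
  s <= phi x -> (forall n, piter g n x <> None) ->
  exists n, piter_in g n x [set y | t < phi y].
Proof.
move=> q1 s0 expand sx total; apply: contrapT => /forallNP trapped.
have q_ge0 : 0 <= q by rewrite ltW// (lt_trans ltr01).
have grow n : piter_in g n x [set y | s * q ^+ n <= phi y].
  elim: n => [|n [y xy /= ny]]; first by exists x; rewrite //= mulr1.
  case xz : (piter g n.+1 x) (total n.+1) => [z|//] _; exists z => //=.
  have sy : s <= phi y.
    by apply: le_trans ny; rewrite ler_peMr ?(ltW s0)// exprn_ege1// ltW.
  have yt : phi y <= t.
    by rewrite leNgt; apply/negP => ty; apply: (trapped n); exists y.
  rewrite exprS mulrCA; apply: (le_trans (ler_wpM2l q_ge0 ny)); apply: expand.
    by rewrite sy.
  by move: xz; rewrite -add1n piterD xy.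
have [n] := exists_expr_gt (t / s) q1; rewrite ltr_pdivrMr// mulrC => tn.
have [y xy ny] := grow n.
by apply: (trapped n); exists y => //=; exact: lt_le_trans tn ny.
Qed.

Lemma has_derivative_lipschitz_slope y v (m : Cp -> Cp) (rho c : R) :
  0 < rho -> 0 < c -> g y = Some v ->
  (forall z, pnorm (z - y) < rho -> exists2 w, g z = Some w &
     w - v = (z - y) * m z /\ pnorm (m z - m y) <= c * pnorm (z - y)) ->
  has_derivative g y (m y).
Proof.
move=> rho0 c0 gy slope; exists v => // e e0.
exists (Num.min rho (e / c)) => [|z zy]; first by rewrite lt_min rho0 divr_gt0.
rewrite lt_min ltr_pdivlMr// mulrC => /andP[/slope[w gz [slope_w lip]] small].
exists w => //; rewrite slope_w mulrAC divff ?subr_eq0// mul1r.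
exact: le_lt_trans lip small.
Qed.

End PartialMap.

(* Total extension of [ratmap], with value [0] at the poles. *)
Definition ratfun (K : fieldType) (a b d x : K) : K :=
  (a * x ^+ 2 + b * x) / (x ^+ 2 + d * x + b).

Section RationalMap.
Variables (R : realType) (p : nat) (Cp : complexPadicField R p).
Variables a b d h1 h2 : Cp.
Hypothesis den_roots : 'X^2 + d *: 'X + b%:P = ('X - h1%:P) * ('X - h2%:P).
Hypotheses (b_neq0 : b != 0) (h1_le_h2 : pnorm h1 <= pnorm h2).
Hypothesis h2_lt_a : pnorm h2 < pnorm a.
Implicit Types x y z : Cp.

Local Notation f := (ratmap a b d).
Local Notation F := (ratfun a b d).
Local Notation den x := (x ^+ 2 + d * x + b).
Local Notation r := (pnorm b / pnorm a).
Local Notation multiplier x := ((d * x + b) / den x).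

Lemma den_factor x : den x = (x - h1) * (x - h2).
Proof. by have := congr1 (fun P => P.[x]) den_roots; rewrite !hornerE. Qed.

Lemma prod_poles : b = h1 * h2.
Proof. by have := den_factor 0; rewrite expr0n mulr0 !add0r mulrNN. Qed.

Lemma sum_poles : d = - (h1 + h2).
Proof.
have -> : d = den 1 - 1 - b by ring.
by rewrite den_factor prod_poles; ring.
Qed.

Lemma pnorm_prod_poles : pnorm b = pnorm h1 * pnorm h2.
Proof. by rewrite prod_poles pnormM. Qed.

Lemma pnorm_sum_poles : pnorm d <= pnorm h2.
Proof. by rewrite sum_poles pnormN pnormD_le. Qed.

Lemma pole1_norm_gt0 : 0 < pnorm h1.
Proof.
by move: b_neq0; rewrite pnorm_gt0 prod_poles mulf_eq0 negb_or => /andP[].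
Qed.

Lemma pole2_norm_gt0 : 0 < pnorm h2.
Proof. exact: lt_le_trans pole1_norm_gt0 h1_le_h2. Qed.

Lemma leading_norm_gt0 : 0 < pnorm a.
Proof. exact: lt_trans pole2_norm_gt0 h2_lt_a. Qed.

#[local] Hint Resolve pole1_norm_gt0 pole2_norm_gt0 leading_norm_gt0 : core.

Lemma radius_gt0 : 0 < r.
Proof. by rewrite divr_gt0// pnorm_gt0. Qed.

Lemma radius_lt_pole1 : r < pnorm h1.
Proof. by rewrite ltr_pdivrMr// pnorm_prod_poles ltr_pM2l. Qed.

Lemma radius_lt_pole2 : r < pnorm h2.
Proof. exact: lt_le_trans radius_lt_pole1 h1_le_h2. Qed.

#[local] Hint Resolve radius_gt0 radius_lt_pole1 radius_lt_pole2 : core.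

Lemma ratmap_None x : f x = None <-> [set h1; h2] x.
Proof.
rewrite /ratmap den_factor mulf_eq0 !subr_eq0.
split => [|[->|->]]; rewrite ?eqxx ?orbT//.
by case: ifP => // /orP[]/eqP; [left|right].
Qed.

Lemma ratmap_Some x y : f x = Some y -> [/\ x != h1, x != h2 & y = F x].
Proof.
rewrite /ratmap /ratfun den_factor mulf_eq0 !subr_eq0.
by have [//|x1] := eqVneq x h1; have [//|x2 [<-]] := eqVneq x h2.
Qed.

Lemma ratmap_inner x : pnorm x < pnorm h1 -> f x = Some (F x).
Proof.
move=> xh1; rewrite /ratmap ifN// den_factor mulf_neq0//.
  by rewrite -pnorm_gt0 pnormB_ltl.
rewrite -pnorm_gt0 pnormB_ltl//.
exact: lt_le_trans xh1 h1_le_h2.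
Qed.

Lemma pnorm_den_outer x : pnorm h2 < pnorm x -> pnorm (den x) = pnorm x ^+ 2.
Proof.
by move=> h2x; rewrite den_factor pnormM !pnormB_ltr// (le_lt_trans h1_le_h2).
Qed.

Lemma den_outer_neq0 x : pnorm h2 < pnorm x -> den x != 0.
Proof.
move=> h2x; rewrite -pnorm_gt0 pnorm_den_outer//.
by rewrite exprn_gt0// (lt_trans _ h2x).
Qed.

Lemma ratmap_outer x : pnorm h2 < pnorm x -> f x = Some (F x).
Proof. by move=> /den_outer_neq0 den0; rewrite /ratmap ifN. Qed.

Lemma pnorm_ratfun x :
  pnorm (F x) = pnorm x * pnorm (a * x + b) / pnorm (den x).
Proof. by rewrite /ratfun pnorm_div -pnormM; congr (pnorm _ / _); ring. Qed.

Lemma pnorm_ratfun_inner x : pnorm x < pnorm h1 ->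
  pnorm (F x) = pnorm x * pnorm (a * x + b) / pnorm b.
Proof.
move=> xh1; rewrite pnorm_ratfun den_factor pnorm_prod_poles pnormM.
rewrite !pnormB_ltl//.
exact: lt_le_trans xh1 h1_le_h2.
Qed.

Lemma pnorm_ratfun_lt_radius x : pnorm x < r -> pnorm (F x) = pnorm x.
Proof.
move=> xr; rewrite pnorm_ratfun_inner ?(lt_trans xr)// pnormD_ltl.
  by rewrite mulfK// gt_eqF// pnorm_gt0.
by rewrite pnormM mulrC -ltr_pdivlMr.
Qed.

Lemma pnorm_ratfun_le_radius x : pnorm x <= r -> pnorm (F x) <= r.
Proof.
move=> xr; rewrite pnorm_ratfun_inner ?(le_lt_trans xr)//.
apply: (le_trans _ xr).
rewrite ler_pdivrMr ?pnorm_gt0// ler_wpM2l ?pnorm_ge0// pnormD_le//.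
by rewrite pnormM mulrC -ler_pdivlMr.
Qed.

Lemma invariant_sphere0 rho : rho < r -> invariant f (sphere rho 0).
Proof.
move=> rho_r x; rewrite sphere0E => xrho; rewrite -xrho in rho_r *.
exists (F x); first by rewrite ratmap_inner// (lt_trans rho_r).
by rewrite sphere0E pnorm_ratfun_lt_radius.
Qed.

Lemma invariant_closedBall0 : invariant f (closedBall r 0).
Proof.
move=> x; rewrite closedBall0E => xr.
exists (F x); first by rewrite ratmap_inner// (le_lt_trans xr).
by rewrite closedBall0E pnorm_ratfun_le_radius.
Qed.

Lemma critical_sphere_not_invariant : ~ invariant f (sphere r 0).
Proof.
have a0 : a != 0 by rewrite -pnorm_gt0.
have wr : pnorm (- b / a) = r by rewrite pnorm_div pnormN.
have Fw : pnorm (F (- b / a)) = 0.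
  by rewrite pnorm_ratfun mulrCA divff// mulr1 addNr pnorm0 mulr0 mul0r.
move=> /(_ (- b / a)); rewrite sphere0E => /(_ wr)[y].
rewrite ratmap_inner ?wr// => -[<-]; rewrite sphere0E Fw => r0.
by have := radius_gt0; rewrite -r0 ltxx.
Qed.

Lemma pnorm_linear_factor x :
  r < pnorm x -> pnorm (a * x + b) = pnorm a * pnorm x.
Proof. by move=> rx; rewrite pnormD_ltr pnormM// mulrC -ltr_pdivrMr. Qed.

(* The ratio [|f x| / |x|] is at least [|x| / r] for [|x| <= |h1|] and at least
   [|a| / |h2|] for [|h1| < |x| <= |h2|]. *)
Lemma pnorm_ratmap_expanding s x y : r < s -> s <= pnorm x <= pnorm h2 ->
  f x = Some y -> Num.min (s / r) (pnorm a / pnorm h2) * pnorm x <= pnorm y.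
Proof.
move=> rs /andP[sx xh2] /ratmap_Some[x_h1 x_h2 ->]; set q := Num.min _ _.
have s_gt0 : 0 < s by exact: lt_trans rs.
have x_gt0 : 0 < pnorm x by exact: lt_le_trans sx.
have q_ge0 : 0 <= q by rewrite le_min !divr_ge0 ?pnorm_ge0 ?(ltW s_gt0).
have den_gt0 : 0 < pnorm (den x).
  by rewrite pnorm_gt0 den_factor mulf_neq0 ?subr_eq0.
rewrite pnorm_ratfun pnorm_linear_factor ?(lt_le_trans rs)//.
rewrite ler_pdivlMr// [leLHS]mulrAC [leLHS]mulrC ler_pM2l//.
have [xh1|h1x] := leP (pnorm x) (pnorm h1).
- have den_le : pnorm (den x) <= pnorm b.
    by rewrite den_factor pnormM pnorm_prod_poles ler_pM ?pnorm_ge0 ?pnormB_le.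
  apply: (@le_trans _ _ (s / r * pnorm b)).
    by rewrite ler_pM ?pnorm_ge0// ge_min lexx.
  rewrite [leLHS](_ : _ = pnorm a * s) ?ler_pM2l//.
  by field; rewrite !gt_eqF// pnorm_gt0.
- have den_le : pnorm (den x) <= pnorm h2 * pnorm x.
    by rewrite den_factor pnormM mulrC ler_pM ?pnorm_ge0 ?pnormB_le// ltW.
  apply: (@le_trans _ _ (pnorm a / pnorm h2 * (pnorm h2 * pnorm x))).
    by rewrite ler_pM ?pnorm_ge0// ge_min lexx orbT.
  by rewrite mulrA divfK// gt_eqF.
Qed.

Lemma pnorm_ratfun_outer x : pnorm h2 < pnorm x -> pnorm (F x) = pnorm a.
Proof.
move=> h2x; have x0 : 0 < pnorm x by exact: lt_trans h2x.
rewrite pnorm_ratfun pnorm_den_outer// pnorm_linear_factor ?(lt_trans _ h2x)//.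
by field; rewrite gt_eqF.
Qed.

Lemma pnorm_fixed_point : pnorm (a - d) = pnorm a.
Proof. by rewrite pnormB_ltr// (le_lt_trans pnorm_sum_poles). Qed.

Lemma ratfun_sub_fixed_point x : pnorm h2 < pnorm x ->
  F x - (a - d) = (x - (a - d)) * multiplier x.
Proof. by move=> /den_outer_neq0 den0; rewrite /ratfun; field. Qed.

Lemma pnorm_multiplier_le x : pnorm h2 < pnorm x ->
  pnorm (multiplier x) <= pnorm h2 / pnorm x.
Proof.
move=> h2x; have x0 : 0 < pnorm x by exact: lt_trans h2x.
rewrite pnorm_div pnorm_den_outer// ler_pdivrMr ?exprn_gt0//.
rewrite expr2 mulrA divfK ?gt_eqF// pnormD_le//.
  by rewrite pnormM ler_wpM2r ?pnorm_ge0// pnorm_sum_poles.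
by rewrite pnorm_prod_poles mulrC ler_pM2l// (le_trans h1_le_h2)// ltW.
Qed.

Lemma multiplier_lipschitz y z : pnorm h2 < pnorm y -> pnorm z = pnorm y ->
  pnorm (multiplier z - multiplier y) <=
    pnorm h2 / pnorm y ^+ 2 * pnorm (z - y).
Proof.
move=> h2y zy; have h2z : pnorm h2 < pnorm z by rewrite zy.
have y0 : 0 < pnorm y by exact: lt_trans h2y.
have -> : multiplier z - multiplier y =
    - ((z - y) * (d * z * y + b * (y + z))) / (den z * den y).
  by field; rewrite !den_outer_neq0.
have num_le : pnorm (d * z * y + b * (y + z)) <= pnorm h2 * pnorm y ^+ 2.
  rewrite pnormD_le// !pnormM ?zy.
    by rewrite -mulrA -expr2 ler_wpM2r ?exprn_ge0 ?pnorm_ge0// pnorm_sum_poles.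
  rewrite pnorm_prod_poles [_ * pnorm h2]mulrC -mulrA ler_pM2l// expr2.
  by rewrite ler_pM ?pnorm_ge0 ?pnormD_le ?zy// (le_trans h1_le_h2)// ltW.
rewrite pnorm_div pnormN !pnormM !pnorm_den_outer// zy.
rewrite ler_pdivrMr ?mulr_gt0 ?exprn_gt0//.
rewrite [leRHS](_ : _ = pnorm (z - y) * (pnorm h2 * pnorm y ^+ 2)).
  by rewrite ler_wpM2l ?pnorm_ge0.
by field; rewrite gt_eqF.
Qed.

Lemma sphere_fixed_point : sphere (pnorm a) 0 (a - d).
Proof. by rewrite sphere0E pnorm_fixed_point. Qed.

Lemma attractive_fixed_point :
  is_fixed_point f (a - d) -> attractive f (a - d).
Proof.
set y := a - d => fy; split => //.
have ya : pnorm y = pnorm a := pnorm_fixed_point.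
have h2y : pnorm h2 < pnorm y by rewrite ya.
exists (multiplier y); last first.
  apply: le_lt_trans (pnorm_multiplier_le h2y) _.
  by rewrite ya ltr_pdivrMr// mul1r.
apply: (@has_derivative_lipschitz_slope _ _ _ _ _ y
          (fun x => multiplier x) (pnorm y) (pnorm h2 / pnorm y ^+ 2)) => //.
- by rewrite ya.
- by rewrite divr_gt0// exprn_gt0// ya.
move=> z near_y; have zy : pnorm z = pnorm y by rewrite -(subrK y z) pnormD_ltl.
have h2z : pnorm h2 < pnorm z by rewrite zy.
exists (F z); first exact: ratmap_outer.
by rewrite ratfun_sub_fixed_point//; split => //; exact: multiplier_lipschitz.
Qed.

Lemma ratmap_contracts x : sphere (pnorm a) 0 x ->
  exists2 y, f x = Some y & sphere (pnorm a) 0 y /\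
    pnorm (y - (a - d)) <= pnorm h2 / pnorm a * pnorm (x - (a - d)).
Proof.
rewrite sphere0E => xa; have h2x : pnorm h2 < pnorm x by rewrite xa.
exists (F x); first exact: ratmap_outer.
split; first by rewrite sphere0E pnorm_ratfun_outer.
rewrite ratfun_sub_fixed_point// pnormM mulrC ler_wpM2r ?pnorm_ge0//.
by rewrite -xa pnorm_multiplier_le.
Qed.

Lemma sphere_sub_basin : sphere (pnorm a) 0 `<=` basin f (a - d).
Proof.
apply: (@basin_contraction _ _ _ _ _ _ (pnorm h2 / pnorm a)).
- by rewrite divr_ge0 ?pnorm_ge0.
- by rewrite ltr_pdivrMr// mul1r.
- exact: ratmap_contracts.
Qed.

Lemma orbit_reaches_sphere x : r < pnorm x -> (forall n, piter f n x <> None) ->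
  exists n, piter_in f n x (sphere (pnorm a) 0).
Proof.
move=> rx total; have x0 : 0 < pnorm x by exact: lt_trans rx.
pose q := Num.min (pnorm x / r) (pnorm a / pnorm h2).
have q1 : 1 < q.
  by rewrite lt_min; apply/andP; split; rewrite ltr_pdivlMr// mul1r.
have [|n xn] := expanding_orbit_escapes (t := pnorm h2) q1 x0 _ (lexx _) total.
  by move=> y z; exact: pnorm_ratmap_expanding.
exists n.+1; apply: piter_inS xn _ => y /= h2y.
by exists (F y); [exact: ratmap_outer | rewrite sphere0E pnorm_ratfun_outer].
Qed.

Lemma closedBall_disjoint_basin x : closedBall r 0 x -> ~ basin f (a - d) x.
Proof.
apply: (basin_disjoint leading_norm_gt0 invariant_closedBall0) => y.
rewrite closedBall0E => yr; rewrite pnormB_ltl pnorm_fixed_point//.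
by rewrite (le_lt_trans yr)// (lt_trans _ h2_lt_a).
Qed.

Lemma basin_fixed_point :
  basin f (a - d) = ~` (closedBall r 0 `|` pole_orbits f h1 h2).
Proof.
rewrite (pole_orbitsE ratmap_None); apply/seteqP; split => x.
  by move=> xA [/closedBall_disjoint_basin|[n]] //; exact: basin_total xA.
move=> /not_orP[]; rewrite closedBall0E => /negP.
rewrite -ltNge => rx /forallNP total.
have [n xn] := orbit_reaches_sphere rx total.
apply: (@basin_piter _ _ _ _ _ n).
by case: xn => y xy /sphere_sub_basin; exists y.
Qed.

End RationalMap.

Theorem theorem3 (R : realType) (p : nat) (hp : prime p)
    (Cp : complexPadicField R p) (a b d h1 h2 : Cp) (alpha beta : R)
    (hab : a * b != 0) (had : a != d)
    (hroots : 'X^2 + d *: 'X + b%:P = ('X - h1%:P) * ('X - h2%:P))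
    (halpha : alpha = pnorm h1) (hbeta : beta = pnorm h2)
    (hfix1 : is_fixed_point (ratmap a b d) 0)
    (hfix2 : is_fixed_point (ratmap a b d) (a - d))
    (halphabeta : alpha = beta) (ha : alpha < pnorm a) :
  let f := ratmap a b d in
  let x1 : Cp := 0 in
  let x2 : Cp := a - d in
  let r : R := alpha ^+ 2 / pnorm a in
  [/\ SI f x1 = openBall r 0 /\ sphere (pnorm a) 0 x2,
      attractive f x2 /\
        basin f x2 = ~` (closedBall r 0 `|` pole_orbits f h1 h2) &
      forall x : Cp, sphere r 0 x ->
        (exists (k : nat) (mu : R),
           [/\ (1 <= k)%N, 0 <= mu, mu < r,
               forall m : nat, (k <= m)%N -> piter_in f m x (sphere mu 0) &
               forall m : nat, (m <= k - 1)%N -> piter_in f m x (sphere r 0)])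
        \/ (forall k : nat, (1 <= k)%N -> piter_in f k x (sphere r 0))].
Proof.
have b0 : b != 0 by apply: contraNneq hab => ->; rewrite mulr0.
have h12 : pnorm h1 = pnorm h2 by rewrite -halpha halphabeta.
have h1_le_h2 : pnorm h1 <= pnorm h2 by rewrite h12.
have h2_lt_a : pnorm h2 < pnorm a by rewrite -h12 -halpha.
have rE : alpha ^+ 2 / pnorm a = pnorm b / pnorm a.
  by rewrite (pnorm_prod_poles hroots) expr2 -h12 -halpha.
rewrite /= rE; split; [split | split | move=> x].
- apply: SI_openBall => //.
  + exact: (radius_gt0 hroots).
  + exact: (invariant_sphere0 hroots).
  + exact: (critical_sphere_not_invariant hroots).
- exact: (sphere_fixed_point hroots).
- exact: (attractive_fixed_point hroots).
- exact: (basin_fixed_point hroots).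
- apply: sphere_orbit_dichotomy.
  + exact: (invariant_sphere0 hroots).
  + exact: (invariant_closedBall0 hroots).
Qed.
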